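(* Let $n\geq 2$, let $x_1<x_2<\cdots$ be the increasing enumeration of $M_{p_n}$, let $d_k=x_{k+1}-x_k$, and let $T=T_{p_n}$ be the minimal period of $(d_k)_{k\geq1}$. For a positive integer $g$ let $\mu(g)=\#\{1\leq j\leq T: d_j=g\}$ be the multiplicity of the gap $g$ in the pattern $(d_1,\dots,d_T)$. Then: (i) $\mu(2)=\mu(4)$, and this common value is odd; (ii) $T$ is even and the central gap is $d_{T/2}=4$; moreover $\mu(g)$ is even for every $g\notin\{2,4\}$.
   Context: $p_1=2<p_2=3<p_3=5<\cdots$ denotes the sequence of all primes. For $n\geq1$, $M_{p_n}$ is the set of positive integers not divisible by any of $p_1,\dots,p_n$. The pattern $\mathcal{P}_{p_n}=(d_1,\dots,d_T)$ is one minimal period of the gap sequence, starting from $x_1=1$; the central gap is the middle entry of $(d_1,\dots,d_{T-1})$. *)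

(* Defs.v *)
From mathcomp Require Import all_boot.

Set Implicit Arguments.
Unset Strict Implicit.
Unset Printing Implicit Defensive.

(* Sequences are 1-based: only the terms of index k >= 1 are meaningful, and
   the value at index 0 is left unconstrained. *)

Definition increasing_enumeration (A : pred nat) (x : nat -> nat) : Prop :=
  (forall i j : nat, 0 < i -> i < j -> x i < x j) /\
  (forall a : nat, A a <-> exists k : nat, 0 < k /\ x k = a).

Definition M (p : nat -> nat) (n : nat) : pred nat :=
  fun m => (0 < m) && [forall i : 'I_n, ~~ (p i.+1 %| m)].

(* The subtraction is never truncated when x is increasing. *)
Definition gap (x : nat -> nat) (k : nat) : nat := x k.+1 - x k.

Definition is_period (d : nat -> nat) (t : nat) : Prop :=
  0 < t /\ forall k : nat, 0 < k -> d (k + t) = d k.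

Definition minimal_period (d : nat -> nat) (T : nat) : Prop :=
  is_period d T /\ forall t : nat, is_period d t -> T <= t.

(* [:: d 1; ...; d T] *)
Definition pattern (d : nat -> nat) (T : nat) : seq nat :=
  [seq d k | k <- iota 1 T].

Definition mu (d : nat -> nat) (T g : nat) : nat := count_mem g (pattern d T).

(* The middle entry of [:: d 1; ...; d (T - 1)], which has a middle when T is
   even; nth is 0-based. *)
Definition central_gap (d : nat -> nat) (T : nat) : nat :=
  nth 0 (pattern d T.-1) (T.-1)./2.

(* Main.v *)
Require Import Defs.
From mathcomp Require Import all_boot.
From mathcomp Require Import zify.

(** Let [P = p_1 ... p_n = 2 Q] with [Q] an odd multiple of 3, so that [M p n]
    is the set of integers coprime to [P].  If the gaps have period [T], this set
    is stable under the shift by [S = x_(T+1) - 1]; a prime factor of [P] not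
    dividing [S] would divide some [1 + k S], so [P] divides [S], and minimality
    of [T] forces [S = P].  The symmetry [m -> P - m] gives
    [d_(T-k) = d_k] for [0 < k < T]; the gaps left unpaired are [d_T = 2] (from
    [P - 1] to [P + 1]) and [d_(T/2) = 4] (from [Q - 2] to [Q + 2]), which settles
    all parities.  Finally [mu 2] and [mu 4] count the residues [m] modulo [P]
    with [m] and [m + 2], respectively [m] and [m + 4], coprime to [P], and
    multiplication by the unit [Q + 2] exchanges the two sets, because
    [2 (Q + 2) = 4] modulo [P]. *)

(** * Increasing enumerations and their gaps *)

Lemma enum_ltn (A : pred nat) (x : nat -> nat) (i j : nat) :
  increasing_enumeration A x -> 0 < i -> 0 < j -> (x i < x j) = (i < j).
Proof.
move=> [incr _] i0 j0; case: (ltngtP i j) => [lt_ij|lt_ji|->].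
- exact: incr.
- by have := incr _ _ j0 lt_ji; lia.
- exact: ltnn.
Qed.

Lemma enum_inj (A : pred nat) (x : nat -> nat) (i j : nat) :
  increasing_enumeration A x -> 0 < i -> 0 < j -> x i = x j -> i = j.
Proof.
move=> hx i0 j0 eq_x.
have := enum_ltn _ _ _ _ hx i0 j0; have := enum_ltn _ _ _ _ hx j0 i0; lia.
Qed.

Lemma enum_mem (A : pred nat) (x : nat -> nat) (k : nat) :
  increasing_enumeration A x -> 0 < k -> A (x k).
Proof. by move=> [_ hA] k0; apply/hA; exists k. Qed.

Lemma enum_ex (A : pred nat) (x : nat -> nat) (a : nat) :
  increasing_enumeration A x -> A a -> exists2 k, 0 < k & x k = a.
Proof. by move=> [_ hA] /hA [k [k0 xk]]; exists k. Qed.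

Lemma enum_succ (A : pred nat) (x : nat -> nat) (k : nat) :
  increasing_enumeration A x -> 0 < k -> x k.+1 = x k + gap x k.
Proof.
by move=> [incr _] k0; rewrite /gap; have := incr k k.+1 k0 (ltnSn _); lia.
Qed.

Lemma gap_gt0 (A : pred nat) (x : nat -> nat) (k : nat) :
  increasing_enumeration A x -> 0 < k -> 0 < gap x k.
Proof. by move=> [incr _] k0; rewrite subn_gt0 incr. Qed.

(** The index of [x k + g] exceeds [k], whence [gap x k <= g]; if this were strict, [x k.+1] would
    be one of the excluded values. Gaps are computed below through this criterion. *)
Lemma gap_unique (A : pred nat) (x : nat -> nat) (k g : nat) :
  increasing_enumeration A x -> 0 < k -> 0 < g -> A (x k + g) ->
  (forall i, 0 < i < g -> ~~ A (x k + i)) -> gap x k = g.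
Proof.
move=> hx k0 g0 Ag nA; have [j j0 xj] := enum_ex _ _ _ hx Ag.
have lt_kj : k < j by rewrite -(enum_ltn _ _ _ _ hx k0 j0); lia.
have le_gap : gap x k <= g.
  have := enum_ltn _ _ j k.+1 hx j0 isT; rewrite (enum_succ _ _ _ hx k0); lia.
have gap0 := gap_gt0 _ _ _ hx k0.
case: (ltngtP (gap x k) g) le_gap => // lt_gap _.
have /negP[] := nA (gap x k) (introT andP (conj gap0 lt_gap)).
by rewrite -(enum_succ _ _ _ hx k0); apply: (enum_mem _ _ _ hx).
Qed.

Lemma gap_nmem (A : pred nat) (x : nat -> nat) (k i : nat) :
  increasing_enumeration A x -> 0 < k -> 0 < i < gap x k -> ~~ A (x k + i).
Proof.
move=> hx k0 lt_i; apply/negP => /(enum_ex _ _ _ hx)[j j0 xj].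
have := enum_ltn _ _ _ _ hx k0 j0; have := enum_ltn _ _ j k.+1 hx j0 isT.
rewrite (enum_succ _ _ _ hx k0); lia.
Qed.

(** Sliding a window of [t] gaps by one step drops [gap x k] and adds the equal [gap x (k + t)], so
    its sum stays that of the first window. *)
Lemma enum_period (A : pred nat) (x : nat -> nat) (t k : nat) :
  increasing_enumeration A x -> is_period (gap x) t -> 0 < k ->
  x (k + t) = x k + (x t.+1 - x 1).
Proof.
move=> hx [t0 per]; elim: k => // -[_ _|k IHk _].
  by rewrite add1n; have := enum_ltn _ _ 1 t.+1 hx isT isT; lia.
rewrite addSn (enum_succ _ _ (k.+1 + t) hx) ?per ?IHk //.
by rewrite (enum_succ _ _ k.+1 hx) // addnAC.
Qed.

(** * Integers coprime to a modulus *)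

Lemma eqmod_coprime (P m m' : nat) :
  m = m' %[mod P] -> coprime m P = coprime m' P.
Proof. by move=> eqm; rewrite -coprime_modl eqm coprime_modl. Qed.

Lemma coprimeDP (P m : nat) : coprime (m + P) P = coprime m P.
Proof. by apply: eqmod_coprime; rewrite modnDr. Qed.

(** Both gcds with [m + m'] reduce to the gcd of [m] and [m']. The additive hypothesis spares
    truncated subtraction. *)
Lemma coprimeBP (P m m' : nat) : m + m' = P -> coprime m P -> coprime m' P.
Proof.
by move=> <-; rewrite /coprime gcdnDl gcdnDr gcdnC.
Qed.

Lemma coprime_enum_gt0 (P : nat) (x : nat -> nat) (k : nat) :
  1 < P -> increasing_enumeration (fun m => coprime m P) x -> 0 < k -> 0 < x k.
Proof.
move=> P1 hx k0; have := enum_mem _ _ _ hx k0; rewrite lt0n.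
by case: eqP => // -> /eqP; rewrite gcd0n; lia.
Qed.

Lemma coprime_enum1 (P : nat) (x : nat -> nat) :
  1 < P -> increasing_enumeration (fun m => coprime m P) x -> x 1 = 1.
Proof.
move=> P1 hx; have [j j0 xj] := enum_ex _ _ 1 hx (coprime1n P).
have := coprime_enum_gt0 _ _ 1 P1 hx isT; have := enum_ltn _ _ j 1 hx j0 isT.
lia.
Qed.

(** * The minimal period and the modulus *)

Lemma shift_stable_dvdn (P S q : nat) :
  (forall m, coprime m P -> coprime (m + S) P) -> prime q -> q %| P -> q %| S.
Proof.
move=> stab q_pr qP; apply/negPn/negP => nqS.
have copS k : coprime (1 + k * S) P.
  elim: k => [|k IHk]; first by rewrite mul0n addn0 coprime1n.
  by rewrite mulSn addnCA addnC; apply: stab.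
have cqS : coprime q S by rewrite prime_coprime.
(* Bezout gives [u.1 * q - u.2 * S = 1], so [q] divides the term of index [u.2] of the
   progression. *)
have [u /= eq_u] := coprimeP _ (prime_gt0 q_pr) cqS.
have := coprime_dvdr qP (copS u.2).
have -> : 1 + u.2 * S = u.1 * q by lia.
by rewrite coprime_sym prime_coprime // dvdn_mull.
Qed.

(* The second hypothesis says that [P] is squarefree. *)
Lemma coprime_minimal_period (P : nat) (x : nat -> nat) (T : nat) :
  1 < P ->
  (forall S, (forall q, prime q -> q %| P -> q %| S) -> P %| S) ->
  increasing_enumeration (fun m => coprime m P) x ->
  minimal_period (gap x) T -> x T.+1 = P.+1.
Proof.
move=> P1 sqfree hx [per minT]; have x1 := coprime_enum1 _ _ P1 hx.
have T0 := per.1.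
have xT : x 1 < x T.+1 by rewrite (enum_ltn _ _ _ _ hx).
have dvdS : P %| x T.+1 - x 1.
  apply: sqfree => q; apply: shift_stable_dvdn => m /(enum_ex _ _ _ hx)[k k0 <-].
  rewrite -(enum_period _ _ _ _ hx per k0).
  by apply: (enum_mem _ _ _ hx); rewrite addn_gt0 k0.
have leS : P <= x T.+1 - x 1 by apply: dvdn_leq; rewrite // subn_gt0.
have copP : coprime P.+1 P by rewrite -add1n coprimeDP coprime1n.
(* Let [P + 1] have index [t + 1]. Then [t <= T] by [leS]; once [t] is known to be a period,
   minimality gives [T <= t]. *)
have [[//|t] _ xt] := enum_ex _ _ _ hx copP.
have t0 : 0 < t by case: t xt => //; lia.
have shift_gap k : 0 < k -> x (k + t) = x k + P -> gap x (k + t) = gap x k.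
  move=> k0 xk; apply: (gap_unique _ _ _ _ hx).
  - by rewrite addn_gt0 k0.
  - exact: gap_gt0 hx k0.
  - rewrite xk addnAC coprimeDP -(enum_succ _ _ _ hx k0).
    exact: (enum_mem _ _ _ hx).
  - move=> i lt_i; rewrite xk addnAC coprimeDP.
    exact: (gap_nmem _ _ _ _ hx k0 lt_i).
have shift k : 0 < k -> x (k + t) = x k + P.
  elim: k => // -[_ _|k IHk _]; first by rewrite add1n xt x1.
  rewrite addSn (enum_succ _ _ (k.+1 + t) hx) // shift_gap ?IHk //.
  by rewrite (enum_succ _ _ k.+1 hx) // addnAC.
have per_t : is_period (gap x) t.
  by split=> // k k0; apply: shift_gap => //; apply: shift.
have := minT _ per_t; have := enum_ltn _ _ T.+1 t.+1 hx isT isT.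
case: (ltngtP T t) => [|//|->//]; lia.
Qed.

(** * The reflection of the units about half the modulus *)

Lemma coprime_enum_symmetric (P : nat) (x : nat -> nat) (T k : nat) :
  2 < P -> increasing_enumeration (fun m => coprime m P) x ->
  0 < T -> x T.+1 = P.+1 -> 0 < k <= T -> x (T.+1 - k) + x k = P.
Proof.
move=> P2 hx T0 xT; have P1 := ltnW P2; have x1 := coprime_enum1 _ _ P1 hx.
have nP : ~~ coprime P P by rewrite /coprime gcdnn; lia.
have xltP j : 0 < j <= T -> x j < P.
  case/andP=> j0 jT; have := enum_ltn _ _ j T.+1 hx j0 isT.
  have : x j <> P by move=> xj; move: nP; rewrite -{1}xj (enum_mem _ _ _ hx j0).
  lia.
elim: k => // -[_ _|k IHk lt_k].
  rewrite subn1 /= x1.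
  (* [P - 1] is directly followed by [P + 1 = x T.+1], so its index is [T]. *)
  have copP1 : coprime P.-1 P.
    by apply: (@coprimeBP P 1); rewrite ?coprime1n //; lia.
  have [j j0 xj] := enum_ex _ _ _ hx copP1.
  have gapj : gap x j = 2.
    apply: (gap_unique _ _ _ _ hx) => //.
      have -> : x j + 2 = 1 + P by lia.
      by rewrite coprimeDP coprime1n.
    by move=> i lt_i; have -> : x j + i = P by lia.
  have := enum_succ _ _ _ hx j0; rewrite gapj => xj1.
  have [] : j.+1 = T.+1 by apply: (enum_inj _ _ _ _ hx) => //; lia.
  by move=> <-; lia.
have {}IHk : x (T.+1 - k.+1) + x k.+1 = P by apply: IHk; lia.
have ltP := xltP k.+2 lt_k.
have xk2 := enum_succ _ _ k.+1 hx isT.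
have gk0 := gap_gt0 _ _ k.+1 hx isT.
have cop : coprime (P - x k.+2) P.
  by apply: coprimeBP (enum_mem _ _ k.+2 hx isT); lia.
have [j j0 xj] := enum_ex _ _ _ hx cop.
(* Reflection carries the gap after [x k.+1] to the gap after [P - x k.+2]; the successor of the
   latter is thus [P - x k.+1], whose index is known by induction. *)
have gapj : gap x j = gap x k.+1.
  apply: (gap_unique _ _ _ _ hx) => //.
    by apply: coprimeBP (enum_mem _ _ k.+1 hx isT); lia.
  move=> i lt_i; have lt_gi : 0 < gap x k.+1 - i < gap x k.+1 by lia.
  have := gap_nmem _ _ k.+1 _ hx isT lt_gi.
  by apply: contra; apply: coprimeBP; lia.
have := enum_succ _ _ _ hx j0; rewrite gapj => xj1.
have : j.+1 = T.+1 - k.+1 by apply: (enum_inj _ _ _ _ hx) => //; lia.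
move=> eqj; have -> : T.+1 - k.+2 = j by lia.
lia.
Qed.

Lemma coprime_gap_last (P : nat) (x : nat -> nat) (T : nat) :
  2 < P -> increasing_enumeration (fun m => coprime m P) x ->
  0 < T -> x T.+1 = P.+1 -> gap x T = 2.
Proof.
move=> P2 hx T0 xT; have := coprime_enum1 _ _ (ltnW P2) hx.
have := coprime_enum_symmetric _ _ _ 1 P2 hx T0 xT T0.
rewrite subn1 /= /gap xT; lia.
Qed.

Lemma coprime_gap_symmetric (P : nat) (x : nat -> nat) (T k : nat) :
  2 < P -> increasing_enumeration (fun m => coprime m P) x ->
  0 < T -> x T.+1 = P.+1 -> 0 < k < T -> gap x (T - k) = gap x k.
Proof.
move=> P2 hx T0 xT lt_k.
have lek : 0 < k <= T by lia.
have lek1 : 0 < k.+1 <= T by lia.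
have := coprime_enum_symmetric _ _ _ _ P2 hx T0 xT lek.
have := coprime_enum_symmetric _ _ _ _ P2 hx T0 xT lek1.
have -> : T.+1 - k = (T - k).+1 by lia.
rewrite subSS /gap; lia.
Qed.

(** * The central gap *)

Lemma coprime_double (Q m : nat) : coprime m (2 * Q) = odd m && coprime m Q.
Proof. by rewrite coprimeMr coprimen2. Qed.

Lemma coprime_dvd3 (Q m : nat) : 3 %| Q -> coprime m Q -> ~~ (3 %| m).
Proof.
by move=> Q3 cop; rewrite -prime_coprime // coprime_sym (coprime_dvdr Q3 cop).
Qed.

Lemma coprime_gap_central (Q : nat) (x : nat -> nat) (T : nat) :
  odd Q -> 3 %| Q -> increasing_enumeration (fun m => coprime m (2 * Q)) x ->
  0 < T -> x T.+1 = (2 * Q).+1 -> ~~ odd T /\ gap x T./2 = 4.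
Proof.
move=> oddQ Q3 hx T0 xT.
have Q2 : 2 < Q by apply: dvdn_leq => //; case: Q oddQ {Q3 hx xT}.
have P2 : 2 < 2 * Q by lia.
have sym := coprime_enum_symmetric _ _ _ _ P2 hx T0 xT.
have nQ k : 0 < k -> x k <> Q.
  move=> k0 xk; have := enum_mem _ _ _ hx k0.
  by rewrite xk coprime_double /coprime gcdnn; lia.
have evT : ~~ odd T.
  apply/negP=> oddT; apply: (nQ (T./2).+1) => //.
  have := sym (T./2).+1; have -> : T.+1 - (T./2).+1 = (T./2).+1 by lia.
  by lia.
split=> //.
have T2 : 0 < T./2 by lia.
have symh : x (T./2).+1 + x T./2 = 2 * Q.
  have := sym T./2; have -> : T.+1 - T./2 = (T./2).+1 by lia.
  by apply; lia.
have lt_h : x T./2 < x (T./2).+1 by rewrite (enum_ltn _ _ _ _ hx).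
have copQ : coprime (Q - 2) (2 * Q).
  rewrite coprime_double oddB ?oddQ //=; last by lia.
  by apply: (@coprimeBP Q 2); rewrite ?coprime2n //; lia.
have [j j0 xj] := enum_ex _ _ _ hx copQ.
(* The term [x T./2] lies below [Q], is odd, and is at least the unit [Q - 2]; so it equals [Q - 2],
   and its mirror image is [Q + 2]. *)
have := enum_ltn _ _ T./2 j hx T2 j0; have := enum_ltn _ _ j (T./2).+1 hx j0 isT.
have := enum_mem _ _ _ hx T2; rewrite coprime_double => /andP[oddh _].
rewrite /gap; lia.
Qed.

(** * Multiplicities as counts of residues, and their parity *)

Lemma sum_modn_mul (P a : nat) (F : nat -> nat) :
  coprime a P -> \sum_(m < P) F m = \sum_(m < P) F (m * a %% P).
Proof.
case: P => [|P] cop; first by rewrite !big_ord0.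
pose h (m : 'I_P.+1) : 'I_P.+1 := Ordinal (ltn_pmod (m * a) (ltn0Sn P)).
have inj_h : injective h.
  (* Assuming [i <= j] keeps the subtraction [j - i] from being truncated. *)
  have aux (i j : 'I_P.+1) : i <= j -> j * a == i * a %[mod P.+1] -> i = j.
    move=> le_ij; rewrite eqn_mod_dvd ?leq_mul2r ?le_ij ?orbT // -mulnBl.
    rewrite Gauss_dvdl 1?coprime_sym // => dvd; apply: val_inj.
    have := ltn_ord j; case: (posnP (j - i)) => [|/dvdn_leq/(_ dvd)] /=; lia.
  move=> i j [/eqP eq_h]; case: (leqP i j) => [le_ij|/ltnW le_ji].
    by apply: aux; rewrite // eq_sym.
  by apply/esym; apply: aux.
by rewrite (reindex_inj inj_h).
Qed.

Lemma sum_coprime_pairs (Q : nat) :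
  odd Q ->
  \sum_(m < 2 * Q) (coprime m (2 * Q) && coprime (m + 2) (2 * Q)) =
  \sum_(m < 2 * Q) (coprime m (2 * Q) && coprime (m + 4) (2 * Q)).
Proof.
move=> oddQ.
(* As [Q] is odd, [Q + 2] is odd and shares no factor with [Q]. *)
have cop : coprime (Q + 2) (2 * Q).
  by rewrite coprime_double oddD oddQ addnC coprimeDP coprime2n.
pose F m : nat := coprime m (2 * Q) && coprime (m + 4) (2 * Q).
rewrite -[RHS]/(\sum_(m < 2 * Q) F m) (sum_modn_mul _ _ F cop).
apply: eq_bigr => m _; congr (nat_of_bool (_ && _)).
  by rewrite coprime_modl coprimeMl cop andbT.
have -> : coprime (m + 2) (2 * Q) = coprime ((m + 2) * (Q + 2)) (2 * Q).
  by rewrite coprimeMl cop andbT.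
apply: eqmod_coprime.
rewrite modnDml; have -> : (m + 2) * (Q + 2) = m * (Q + 2) + 4 + 2 * Q by lia.
by rewrite modnDr.
Qed.

(** The values [x 1, ..., x T] are exactly the residues below [P] coprime to [P], so counting
    indices becomes counting residues. The last hypothesis says that no unit can separate [x k] from
    a unit [x k + g]. *)
Lemma mu_coprime_sum (P : nat) (x : nat -> nat) (T g : nat) :
  1 < P -> increasing_enumeration (fun m => coprime m P) x ->
  x T.+1 = P.+1 ->
  (forall k, 0 < k -> (gap x k == g) = coprime (x k + g) P) ->
  mu (gap x) T g = \sum_(m < P) (coprime m P && coprime (m + g) P).
Proof.
move=> P1 hx xT gapE.
have perm_x : perm_eq [seq x k | k <- iota 1 T] [seq m <- iota 0 P | coprime m P].
  apply: uniq_perm; last 1 first.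
  - move=> m; rewrite mem_filter mem_iota /= add0n.
    apply/mapP/andP => [[k]|[cop lt_m]].
      rewrite mem_iota => lt_k ->; have k0 : 0 < k by lia.
      have cop := enum_mem _ _ _ hx k0; split=> //.
      have := enum_ltn _ _ k T.+1 hx k0 isT.
      have : x k <> P by move=> xk; move: cop; rewrite xk /coprime gcdnn; lia.
      lia.
    have [k k0 xk] := enum_ex _ _ _ hx cop; exists k => //.
    by rewrite mem_iota; have := enum_ltn _ _ k T.+1 hx k0 isT; lia.
  - rewrite map_inj_in_uniq ?iota_uniq // => i j; rewrite !mem_iota => lt_i lt_j.
    by apply: (enum_inj _ _ _ _ hx); lia.
  - by rewrite filter_uniq ?iota_uniq.
have -> : mu (gap x) T g =
    count (fun m => coprime (m + g) P) [seq x k | k <- iota 1 T].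
  rewrite /mu /pattern !count_map; apply: eq_in_count => k; rewrite mem_iota /=.
  by case/andP=> k0 _; apply: gapE.
rewrite (permP perm_x) count_filter -sum1_count big_mkcond /=.
pose F m : nat := coprime m P && coprime (m + g) P.
rewrite -[RHS]/(\sum_(m < P) F m) -(big_mkord xpredT F) /index_iota subn0.
by apply: eq_bigr => m _; rewrite /F andbC; case: andb.
Qed.

Lemma odd_mu_palindrome (d : nat -> nat) (h g : nat) :
  0 < h -> (forall k, 0 < k < 2 * h -> d (2 * h - k) = d k) ->
  odd (mu d (2 * h) g) = (d h == g) (+) (d (2 * h) == g).
Proof.
move=> h0 sym.
have -> : mu d (2 * h) g = \sum_(1 <= k < (2 * h).+1) (d k == g).
  rewrite /mu /pattern count_map -sum1_count big_mkcond /index_iota subSS subn0.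
  by apply: eq_bigr => k _ /=; case: eqP.
rewrite big_nat_recr; last by lia.
rewrite (@big_cat_nat _ _ _ h) /=; [|lia|lia].
rewrite (@big_ltn _ _ _ h); last by lia.
rewrite -(add1n h) big_addn; have -> : 2 * h - h = h by lia.
(* Reversal turns the index [k + h] of the upper block into [2 * h - k], so this block duplicates
   the lower one and cancels it modulo 2; the terms at [h] and [2 * h] remain. *)
rewrite [X in _ + (_ + X)]big_nat_rev.
rewrite [X in _ + (_ + X)](_ : _ = \sum_(1 <= k < h) (d k == g)); last first.
  rewrite !big_nat; apply: eq_bigr => k lt_k; rewrite -(sym k); last by lia.
  by congr (nat_of_bool (d _ == g)); lia.
by rewrite !oddD !oddb; case: odd; case: eqP; case: eqP.
Qed.

(** The only integer in between is even, since [x k] is odd. *)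
Lemma coprime_gap2E (Q : nat) (x : nat -> nat) (k : nat) :
  increasing_enumeration (fun m => coprime m (2 * Q)) x -> 0 < k ->
  (gap x k == 2) = coprime (x k + 2) (2 * Q).
Proof.
move=> hx k0; apply/eqP/idP => [gapk|cop].
  by have := enum_mem _ _ k.+1 hx isT; rewrite (enum_succ _ _ _ hx k0) gapk.
apply: (gap_unique _ _ _ _ hx) => // i lt_i.
have -> : i = 1 by lia.
have := enum_mem _ _ _ hx k0; rewrite !coprime_double addn1 /=.
by case/andP=> ->.
Qed.

(* Of [m], [m + 2], [m + 4] one is divisible by 3. *)
Lemma coprime_gap4E (Q : nat) (x : nat -> nat) (k : nat) :
  3 %| Q -> increasing_enumeration (fun m => coprime m (2 * Q)) x -> 0 < k ->
  (gap x k == 4) = coprime (x k + 4) (2 * Q).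
Proof.
move=> Q3 hx k0; apply/eqP/idP => [gapk|cop].
  by have := enum_mem _ _ k.+1 hx isT; rewrite (enum_succ _ _ _ hx k0) gapk.
apply: (gap_unique _ _ _ _ hx) => // i lt_i; apply/negP.
have := enum_mem _ _ _ hx k0; move: cop; rewrite !coprime_double.
move=> /andP[_ /(coprime_dvd3 _ _ Q3) n4] /andP[odd0 /(coprime_dvd3 _ _ Q3) n0].
move=> /andP[oddi /(coprime_dvd3 _ _ Q3) ni].
have i2 : i = 2 by lia.
by subst i; lia.
Qed.

(** * The primes and their initial products *)

Lemma enum_prime1 (p : nat -> nat) :
  increasing_enumeration prime p -> p 1 = 2.
Proof.
move=> hp; have [j j0 pj] := enum_ex _ _ 2 hp isT.
have := prime_gt1 (enum_mem _ _ 1 hp isT); have := enum_ltn _ _ j 1 hp j0 isT.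
lia.
Qed.

Lemma enum_prime2 (p : nat -> nat) :
  increasing_enumeration prime p -> p 2 = 3.
Proof.
move=> hp; have p1 := enum_prime1 _ hp.
have [j j0 pj] := enum_ex _ _ 3 hp isT.
have := enum_ltn _ _ 1 2 hp isT isT; have := enum_ltn _ _ j 2 hp j0 isT.
have := enum_ltn _ _ 1 j hp isT j0; lia.
Qed.

(** Distinct primes are coprime, so their divisibilities multiply. This supplies the squarefreeness
    asked by [coprime_minimal_period]. *)
Lemma primorial_dvdn (p : nat -> nat) (n S : nat) :
  increasing_enumeration prime p ->
  (forall i, i < n -> p i.+1 %| S) -> \prod_(i < n) p i.+1 %| S.
Proof.
move=> hp; elim: n => [_|n IHn dvdS]; first by rewrite big_ord0 dvd1n.
rewrite big_ord_recr /= Gauss_dvd ?dvdS ?andbT //.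
  by apply: IHn => i lt_i; apply: dvdS; apply: ltnW.
rewrite coprime_sym prime_coprime ?(enum_mem _ _ _ hp) //.
rewrite Euclid_dvd_prod ?(enum_mem _ _ _ hp) // big_has_cond.
apply/hasPn => i _ /=; rewrite dvdn_prime2 ?(enum_mem _ _ _ hp) //.
by apply/eqP => /(enum_inj _ _ n.+1 i.+1 hp isT isT); have := ltn_ord i; lia.
Qed.

Lemma M_coprime (p : nat -> nat) (n m : nat) :
  increasing_enumeration prime p -> 0 < n ->
  M p n m = coprime m (\prod_(i < n) p i.+1).
Proof.
move=> hp n0.
have -> : coprime m (\prod_(i < n) p i.+1) = [forall i : 'I_n, ~~ (p i.+1 %| m)].
  apply/idP/forallP => [cop i|ndvd].
    rewrite -prime_coprime ?(enum_mem _ _ _ hp) // coprime_sym.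
    by apply: coprime_dvdr cop; rewrite (bigD1 i) //= dvdn_mulr.
  elim/big_ind: _ => [|a b copa copb|i _]; first exact: coprimen1.
    by rewrite coprimeMr copa.
  by rewrite coprime_sym prime_coprime ?ndvd ?(enum_mem _ _ _ hp).
(* Only [m = 0] is left: [M] excludes it by positivity, the product because [p 1] divides [0]. *)
rewrite /M; case: m => //=; apply/esym/negP => /forallP/(_ (Ordinal n0)).
by rewrite dvdn0.
Qed.

Theorem theorem3 (p : nat -> nat) (n : nat) (x : nat -> nat) (T : nat)
    (hp : increasing_enumeration prime p)
    (hn : 2 <= n)
    (hx : increasing_enumeration (M p n) x)
    (hT : minimal_period (gap x) T) :
  (mu (gap x) T 2 = mu (gap x) T 4 /\ odd (mu (gap x) T 2)) /\
  ((~~ odd T /\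
    central_gap (gap x) T = gap x T./2 /\
    gap x T./2 = 4) /\
   (forall g : nat, 0 < g -> g \notin [:: 2; 4] -> ~~ odd (mu (gap x) T g))).
Proof.
have n0 := ltnW hn.
have [Q PE [oddQ Q3]] :
    exists2 Q, \prod_(i < n) p i.+1 = 2 * Q & odd Q /\ 3 %| Q.
  case: n hn {hx n0} => [|[|n]] // _.
  (* Here [n] has been lowered by 2: the factors are [p 2 = 3] and the primes from [p 3] on, all
     odd. *)
  exists (3 * \prod_(i < n) p i.+3).
    by rewrite !big_ord_recl /= (enum_prime1 _ hp) (enum_prime2 _ hp).
  split; last exact: dvdn_mulr.
  rewrite oddM /=; elim/big_ind: _ => // [a b|i _].
    by rewrite oddM => -> ->.
  have := enum_ltn _ _ 1 i.+3 hp isT isT; rewrite (enum_prime1 _ hp).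
  by case: (even_prime (enum_mem _ _ i.+3 hp isT)) => // ->.
have {}hx : increasing_enumeration (fun m => coprime m (2 * Q)) x.
  by case: hx => incr memE; split=> // a; rewrite -PE -M_coprime.
have Q2 : 2 < Q by apply: dvdn_leq => //; case: Q oddQ {PE Q3 hx}.
have P2 : 2 < 2 * Q by lia.
have T0 : 0 < T by case: hT => -[].
have xT : x T.+1 = (2 * Q).+1.
  apply: coprime_minimal_period (ltnW P2) _ hx hT => S dvdS.
  rewrite -PE; apply: primorial_dvdn => // i lt_i.
  apply: dvdS; first exact: (enum_mem _ _ _ hp).
  by rewrite -PE (bigD1 (Ordinal lt_i)) //= dvdn_mulr.
have [evT gapT2] := coprime_gap_central _ _ _ oddQ Q3 hx T0 xT.
have gapT := coprime_gap_last _ _ _ P2 hx T0 xT.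
have TE : T = 2 * T./2 by lia.
have odd_mu g : odd (mu (gap x) T g) = (4 == g) (+) (2 == g).
  have := odd_mu_palindrome (gap x) T./2 g; rewrite -TE gapT2 gapT.
  by apply=> [|k]; [lia | apply: coprime_gap_symmetric P2 hx T0 xT].
split; [split|split; [split=> //; split=> //|]].
- rewrite !(mu_coprime_sum _ _ _ _ (ltnW P2) hx xT).
  + exact: sum_coprime_pairs.
  + by move=> k; apply: coprime_gap4E.
  + by move=> k; apply: coprime_gap2E.
- by rewrite odd_mu.
(* For even [T] the 0-based position [(T.-1)./2] is [T./2 - 1], which holds the gap of 1-based index
   [T./2]. *)
- rewrite /central_gap /pattern (nth_map 0) ?size_iota ?nth_iota; try by lia.
  by congr (gap x _); lia.
- move=> g g0; rewrite !inE odd_mu (eq_sym 4) (eq_sym 2).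
  by case: eqP => // _ /=; case: eqP.
Qed.
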